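(* There exists a polynomial $p$ in three variables with the following property. Let $d\ge 1$, $\sigma>0$, and let $A=\{A_1,\dotsc,A_{d+1}\}$ be a set of independent Gaussian random vectors in $\mathbb{R}^d$, where $A_i$ has mean $\mu_i$ with $\|\mu_i\|\le 1$ ($i\in[d+1]$) and covariance matrix $\sigma^2 \mathbf{I}_d$. Then for every $\delta>0$, with probability at least $1-\delta$, the measure of conditioning \[ \kappa=\frac{\operatorname{PWidth}(A)}{\operatorname{diam}(A)} \] satisfies $\kappa\ge 1/p(d,1/\sigma,1/\delta)$ (i.e. $\kappa$ is at least some inverse polynomial in $d$, $1/\sigma$, $1/\delta$).
   Context: For a finite set $A\subseteq\mathbb{R}^d$, $\operatorname{diam}(A)=\max_{a,b\in A}\|a-b\|$. For a direction $r\neq 0$ let $s(A,r)\in\operatorname{argmax}_{v\in A}\langle r,v\rangle$. For $x\in\operatorname{conv}(A)$ let $S_x=\{T\subseteq A : x \text{ is a proper convex combination of all the elements of } T\}$ (i.e. a convex combination with all coefficients strictly positive). The pyramidal directional width is $\operatorname{PDirW}(A,r,x)=\min_{S\in S_x}\max_{s\in A,\,v\in S}\langle r/\|r\|, s-v\rangle$. The pyramidal width of a finite set $A$ is \[ \operatorname{PWidth}(A)=\min\{\operatorname{PDirW}(K\cap A,r,x) : K \text{ a face of } \operatorname{conv}(A),\ x\in K,\ r\in\operatorname{cone}(K-x)\setminus\{0\}\}, \] where $\operatorname{cone}(K-x)$ is the conic hull of $\{y-x:y\in K\}$. *)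

(* Defs.v *)
From mathcomp Require Import all_boot all_order all_algebra.
From mathcomp Require Import all_classical all_reals all_analysis.
From mathcomp Require mpoly.
Import numFieldNormedType.Exports.

Set Implicit Arguments.
Unset Strict Implicit.
Unset Printing Implicit Defensive.

Import Order.TTheory GRing.Theory Num.Theory.

Local Open Scope classical_set_scope.
Local Open Scope ring_scope.

Section euclidean.
Context {R : realType} {d : nat}.
Implicit Types (A K : set 'rV[R]_d) (x r u v : 'rV[R]_d).

(* The library's `|u| on row vectors is the sup norm, not the Euclidean one. *)
Definition dot u v : R := \sum_(j < d) u 0 j * v 0 j.

Definition enorm u : R := Num.sqrt (dot u u).

(* In [diam] and [PDirW] below, sup and inf are a max and a min when A is
   finite and nonempty and x is in conv A (the values then form finite
   nonempty sets). *)
Definition diam A : R := sup [set enorm (a - b) | a in A & b in A].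

Definition conv_hull A : set 'rV[R]_d :=
  [set x | exists n (a : 'I_n -> 'rV[R]_d) (c : 'I_n -> R),
    [/\ forall i, A (a i), forall i, 0 <= c i,
        \sum_(i < n) c i = 1 & x = \sum_(i < n) c i *: a i]].

Definition conic_hull A : set 'rV[R]_d :=
  [set x | exists n (a : 'I_n -> 'rV[R]_d) (c : 'I_n -> R),
    [/\ forall i, A (a i), forall i, 0 <= c i
      & x = \sum_(i < n) c i *: a i]].

(* K is cut out of the polytope C by a valid linear inequality; the inequality
   0 <= 0 makes C a face of itself. *)
Definition face (C K : set 'rV[R]_d) : Prop :=
  exists c b, (forall x, C x -> dot c x <= b) /\
              K = C `&` [set x | dot c x = b].

Definition proper_convex_comb (S : set 'rV[R]_d) x : Prop :=
  finite_set S /\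
  exists c : 'rV[R]_d -> R,
    [/\ forall v, S v -> 0 < c v, \sum_(v \in S) c v = 1
      & x = \sum_(v \in S) c v *: v].

Definition Sx A x : set (set 'rV[R]_d) :=
  [set S | S `<=` A /\ proper_convex_comb S x].

Definition PDirW A r x : R :=
  inf [set sup [set dot ((enorm r)^-1 *: r) (s - v) | s in A & v in S]
      | S in Sx A x].

(* For finite A with at least two points the infimum is attained: it is the
   distance from a proper nonempty face F of conv A to conv (A minus F),
   minimized over F (the facial distance of Pena and Rodriguez). *)
Definition PWidth A : R :=
  inf [set w | exists K x r,
    [/\ face (conv_hull A) K, K x,
        conic_hull [set y - x | y in K] r, r != 0
      & w = PDirW (K `&` A) r x]].

Definition kappa A : R := PWidth A / diam A.

End euclidean.

Section gaussian.
Context {R : realType} {dT : measure_display} {T : measurableType dT}.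
Variable P : probability T R.

Definition borel (d : nat) : set (set 'rV[R]_d) := <<s open >>.

Definition random_vector (d : nat) (X : T -> 'rV[R]_d) : Prop :=
  forall B, borel B -> measurable (X @^-1` B).

(* The index type is finite and each B i may be the whole space, so this
   contains the product rule for every subfamily. *)
Definition independent_vectors (I : finType) (d : nat)
    (X : I -> T -> 'rV[R]_d) : Prop :=
  forall B : I -> set 'rV[R]_d, (forall i, borel (B i)) ->
    P (\bigcap_(i in [set: I]) (X i @^-1` B i)) =
    (\prod_(i : I) P (X i @^-1` B i))%E.

(* One-dimensional Gaussian law of mean m and standard deviation s, degenerate
   case included; [normal_prob m 0] is not a Dirac mass. *)
Definition gaussian_law (m s : R) (B : set R) : \bar R :=
  if s == 0 then \d_m B else normal_prob m s B.

(* Every linear functional of X is Gaussian. *)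
Definition gaussian_vector (d : nat) (X : T -> 'rV[R]_d) : Prop :=
  random_vector X /\
  forall u : 'rV[R]_d, exists m s : R, 0 <= s /\
    forall B : set R, measurable B ->
      P ((fun t => dot u (X t)) @^-1` B) = gaussian_law m s B.

Definition coord (d : nat) (X : T -> 'rV[R]_d) (j : 'I_d) : T -> R :=
  fun t => X t 0 j.

Definition has_mean (d : nat) (X : T -> 'rV[R]_d) (mu : 'rV[R]_d) : Prop :=
  forall j : 'I_d, ('E_P[coord X j] = (mu ord0 j)%:E)%E.

Definition has_covariance (d : nat) (X : T -> 'rV[R]_d) (V : 'M[R]_d) : Prop :=
  forall j k : 'I_d,
    covariance P (coord X j) (coord X k) = (V j k)%:E.

End gaussian.

Definition eval3 {R : realType} (p : mpoly.mpoly 3 R) (x y z : R) : R :=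
  mpoly.meval (tnth [tuple x; y; z]) p.

(* Main.v *)
(* The [d + 1] points almost surely span a simplex.  For such a set, a feasible
   direction [r] at [x] transfers a mass [M] from the vertices representing [x]
   to other vertices, so the pyramidal width is at least the smallest height of
   the simplex divided by [d + 1].  Fix all points but [A_i], and let [u] be a
   unit normal to a hyperplane through them: [<u, A_i>] is an independent
   one-dimensional Gaussian of deviation [sigma], whose density is bounded by
   [1 / sigma] up to a constant, so by Fubini the [i]-th height is below [e] with
   probability [O(e / sigma)].  Chebyshev's inequality bounds the diameter. *)
Require Import Defs.
From mathcomp Require Import all_boot all_order all_algebra.
From mathcomp Require Import all_classical all_reals all_analysis.
From mathcomp Require Import measurable_realfun.
From mathcomp Require Import(canonicals) mpoly.
From mathcomp Require Import ring lra.
Import numFieldNormedType.Exports.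
Import Order.TTheory GRing.Theory Num.Theory.

Local Open Scope classical_set_scope.
Local Open Scope ring_scope.

(** * Euclidean geometry *)

Section dot.
Context {R : realType} {d : nat}.
Implicit Types (u v w : 'rV[R]_d) (k : R).

Lemma dotC u v : dot u v = dot v u.
Proof. by apply: eq_bigr => j _; rewrite mulrC. Qed.

Lemma dotDl u v w : dot (u + v) w = dot u w + dot v w.
Proof. by rewrite -big_split; apply: eq_bigr => j _; rewrite mxE mulrDl. Qed.

Lemma dotZl k u v : dot (k *: u) v = k * dot u v.
Proof. by rewrite mulr_sumr; apply: eq_bigr => j _; rewrite mxE mulrA. Qed.

Lemma dotDr u v w : dot u (v + w) = dot u v + dot u w.
Proof. by rewrite dotC dotDl !(dotC u). Qed.

Lemma dotZr k u v : dot u (k *: v) = k * dot u v.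
Proof. by rewrite dotC dotZl dotC. Qed.

Lemma dotNr u v : dot u (- v) = - dot u v.
Proof. by rewrite -scaleN1r dotZr mulN1r. Qed.

Lemma dotBr u v w : dot u (v - w) = dot u v - dot u w.
Proof. by rewrite dotDr dotNr. Qed.

Lemma dot0r u : dot u 0 = 0.
Proof. by rewrite -(scale0r u) dotZr mul0r. Qed.

Lemma dot_sumr (I : Type) (s : seq I) (Q : pred I) (F : I -> 'rV[R]_d) u :
  dot u (\sum_(i <- s | Q i) F i) = \sum_(i <- s | Q i) dot u (F i).
Proof.
by apply: (big_morph (dot u)) => [v w|]; [rewrite dotDr|rewrite dot0r].
Qed.

Lemma dot_ge0 u : 0 <= dot u u.
Proof. by apply: sumr_ge0 => j _; rewrite -expr2 sqr_ge0. Qed.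

Lemma dot_eq0 u : (dot u u == 0) = (u == 0).
Proof.
apply/idP/eqP => [|->]; last by rewrite dot0r.
rewrite psumr_eq0 => [/allP u0|j _]; last by rewrite -expr2 sqr_ge0.
apply/rowP => j; rewrite mxE; apply/eqP.
by have := u0 j (mem_index_enum _); rewrite mulf_eq0 orbb.
Qed.

Lemma sqr_enorm u : enorm u ^+ 2 = dot u u.
Proof. by rewrite sqr_sqrtr ?dot_ge0. Qed.

Lemma enorm_ge0 u : 0 <= enorm u. Proof. exact: sqrtr_ge0. Qed.

Lemma enorm_gt0 u : (0 < enorm u) = (u != 0).
Proof. by rewrite sqrtr_gt0 lt_def dot_ge0 dot_eq0 andbT. Qed.

Lemma enormZ k u : enorm (k *: u) = `|k| * enorm u.
Proof. by rewrite /enorm dotZl dotZr mulrA -expr2 sqrtrM ?sqr_ge0// sqrtr_sqr. Qed.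

(** Cauchy-Schwarz, from the nonnegative squared norm of [dot u u *: v - dot u v *: u], which is
    [dot u u] times the component of [v] orthogonal to [u]. *)
Lemma dot_le_enorm u v : `|dot u v| <= enorm u * enorm v.
Proof.
have [->|u0] := eqVneq u 0.
  by rewrite dotC dot0r normr0 mulr_ge0 ?enorm_ge0.
rewrite -(@ler_pXn2r _ 2) ?nnegrE ?mulr_ge0 ?enorm_ge0//.
rewrite exprMn !sqr_enorm real_normK ?num_real//.
have uu0 : 0 < dot u u by rewrite lt_def dot_ge0 dot_eq0 u0.
have := dot_ge0 (dot u u *: v - dot u v *: u).
have -> : dot (dot u u *: v - dot u v *: u) (dot u u *: v - dot u v *: u) =
    dot u u * (dot u u * dot v v - dot u v ^+ 2).
  by rewrite dotBr !(dotC (_ - _)) !dotBr !dotZl !dotZr (dotC v u); ring.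
by rewrite pmulr_rge0// subr_ge0.
Qed.

Lemma enormD u v : enorm (u + v) <= enorm u + enorm v.
Proof.
rewrite -(@ler_pXn2r _ 2) ?nnegrE ?addr_ge0 ?enorm_ge0//.
rewrite sqr_enorm dotDl !dotDr sqrrD !sqr_enorm (dotC v u).
by have := le_trans (ler_norm _) (dot_le_enorm u v); lra.
Qed.

Lemma enorm_sum (I : finType) (F : I -> 'rV[R]_d) :
  enorm (\sum_i F i) <= \sum_i enorm (F i).
Proof.
elim/big_ind2 : _ => // [|u a v b ua vb]; first by rewrite /enorm dot0r sqrtr0.
by rewrite (le_trans (enormD _ _))// lerD.
Qed.

Lemma enorm_le_sum u : enorm u <= \sum_j `|u 0 j|.
Proof.
rewrite -(@ler_pXn2r _ 2) ?nnegrE ?enorm_ge0 ?sumr_ge0//.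
rewrite sqr_enorm expr2 mulr_suml; apply: ler_sum => j _.
rewrite (le_trans (ler_norm _))// normrM ler_wpM2l//.
by rewrite (bigD1 j)//= lerDl sumr_ge0.
Qed.

Lemma abs_coord_le_enorm u j : `|u 0 j| <= enorm u.
Proof.
rewrite -(@ler_pXn2r _ 2) ?nnegrE ?enorm_ge0// sqr_enorm real_normK ?num_real//.
rewrite /dot (bigD1 j)//= -expr2 lerDl sumr_ge0// => k _.
by rewrite -expr2 sqr_ge0.
Qed.

End dot.

(** * Pyramidal width of a simplex *)

(* Since the coefficients sum to 0, [sum_j c_j a_j] is [c_i] times the vector
   from a point of the affine hull of the other [a_j] to [a_i]: all the heights
   of the simplex with vertices [a_i] are at least [e]. *)
Definition heights_ge {R : realType} {d n : nat} (a : 'I_n -> 'rV[R]_d) (e : R) :=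
  forall c : 'I_n -> R, \sum_i c i = 0 ->
  forall i, e * `|c i| <= enorm (\sum_j c j *: a j).

Section simplex.
Context {R : realType} {d n : nat} (a : 'I_n -> 'rV[R]_d).

Let A : set 'rV[R]_d := [set a i | i in [set: 'I_n]].

(** [conv_hull] allows families of any length with repetitions; choosing an index for each point and
    grouping the weights by index leaves one weight per vertex. *)
Lemma conv_hull_range x : conv_hull A x ->
  exists g : 'I_n -> R,
    [/\ forall i, 0 <= g i, \sum_i g i = 1 & x = \sum_i g i *: a i].
Proof.
move=> [m [b [c [bA c0 c1 ->]]]].
have /choice[f fE] : forall k, exists i, b k = a i.
  by move=> k; have [i _ <-] := bA k; exists i.
exists (fun i => \sum_(k | f k == i) c k); split.
- by move=> i; apply: sumr_ge0.
- by rewrite -c1 (partition_big f xpredT).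
- rewrite (partition_big f xpredT)//=; apply: eq_bigr => i _.
  by rewrite scaler_suml; apply: eq_bigr => k /eqP <-; rewrite fE.
Qed.

(** The slacks of the inequality cutting out [K] are nonnegative at the vertices and their
    [g]-average is 0, so the slack vanishes wherever the weight is positive. *)
Lemma mem_face K g : face (conv_hull A) K ->
  (forall i, 0 <= g i) -> \sum_i g i = 1 -> K (\sum_i g i *: a i) ->
  forall i, 0 < g i -> K (a i).
Proof.
move=> [c [b [Kb ->]]] g0 g1 /= [_ Kg] i gi.
have aA j : conv_hull A (a j).
  exists 1, (fun=> a j), (fun=> 1); split=> //; rewrite ?big_ord1 ?scale1r//.
  by move=> _; exists j.
split; first exact: aA.
have : \sum_j g j * (b - dot c (a j)) = 0.
  under eq_bigr do rewrite mulrBr.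
  rewrite sumrB -mulr_suml g1 mul1r -[X in X - _]Kg dot_sumr.
  by under eq_bigr do rewrite dotZr; rewrite subrr.
move=> /(psumr_eq0P _) => /(_ _ i isT)/eqP.
rewrite mulf_eq0 gt_eqF//= subr_eq0 => /(_ _)/eqP -> // j _.
by rewrite mulr_ge0// subr_ge0 Kb.
Qed.

Lemma fsbig_range_inj {V : nmodType} (S : set 'rV[R]_d) (F : 'rV[R]_d -> V) :
  injective a -> S `<=` A ->
  \sum_(v \in S) F v = \sum_i (if a i \in S then F (a i) else 0).
Proof.
move=> ainj SA.
rewrite (fsbigE [seq a i | i <- index_enum _ & a i \in S]); last 3 first.
- by rewrite map_inj_uniq// filter_uniq// index_enum_uniq.
- by move=> v /= /mapP[i]; rewrite mem_filter => /andP[aiS _] ->; exact: set_mem aiS.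
- move=> v Sv /negP[]; have [i _ iv] := SA _ Sv; apply/mapP; exists i => //.
  by rewrite mem_filter mem_index_enum andbT iv mem_set.
rewrite big_map big_filter_cond/= -big_mkcond/=.
by apply: eq_bigl => i; rewrite andbb.
Qed.

(** The height condition is applied to the coefficients 1 at [i], -1 at [j] and 0 elsewhere. *)
Lemma heights_ge_dist e i j : heights_ge a e -> i != j -> e <= enorm (a i - a j).
Proof.
move=> hae ij; pose dl (i k : 'I_n) : R := (k == i)%:R.
have sum_dl k : \sum_l dl k l = 1.
  rewrite (bigD1 k)//= /dl eqxx big1 ?addr0// => l /negbTE lk.
  by rewrite lk.
have sum_dla k : \sum_l dl k l *: a l = a k.
  rewrite (bigD1 k)//= /dl eqxx scale1r big1 ?addr0// => l /negbTE lk.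
  by rewrite lk scale0r.
have := hae (fun k => dl i k - dl j k); rewrite sumrB !sum_dl subrr => /(_ erefl i).
under eq_bigr do rewrite scalerBl.
by rewrite sumrB !sum_dla /dl eqxx (negbTE ij) subr0 normr1 mulr1.
Qed.

Lemma heights_ge_inj e : 0 < e -> heights_ge a e -> injective a.
Proof.
move=> e0 hae i j aij; apply/eqP; apply: contraTT e0 => ij.
by rewrite -leNgt (le_trans (heights_ge_dist _ _ _ hae ij))// aij subrr /enorm dot0r sqrtr0.
Qed.

(** Rules out the default value 0 of the infimum over an empty set in [PDirW]. The vertices in the
    support of [g] form the required set. *)
Lemma Sx_nonempty B x (g : 'I_n -> R) : injective a -> B `<=` A ->
  (forall i, 0 <= g i) -> \sum_i g i = 1 -> x = \sum_i g i *: a i ->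
  (forall i, 0 < g i -> B (a i)) -> Sx B x !=set0.
Proof.
move=> ainj BA g0 g1 xE gB.
pose S : set 'rV[R]_d := [set a i | i in [set i | 0 < g i]].
have SA : S `<=` A by move=> _ [i _ <-]; exists i.
pose c v := \sum_(i | a i == v) g i.
have cE i : c (a i) = g i.
  by rewrite /c (eq_bigl (pred1 i)) ?big_pred1_eq// => j; rewrite (inj_eq ainj).
have aS i : (a i \in S) = (0 < g i).
  apply/idP/idP; last by move=> gi; rewrite inE; exists i.
  by rewrite inE => -[j /= gj /ainj <-].
exists S; split; first by move=> _ [i /= gi <-]; exact: gB.
split; first exact: finite_image.
exists c; split.
- by move=> _ [i /= gi <-]; rewrite cE.
- rewrite fsbig_range_inj// -g1; apply: eq_bigr => i _; rewrite aS cE.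
  by have := g0 i; rewrite le_eqVlt => /predU1P[<-|->]//; rewrite ltxx.
- rewrite fsbig_range_inj// xE; apply: eq_bigr => i _; rewrite aS cE.
  by have := g0 i; rewrite le_eqVlt => /predU1P[<-|->]//; rewrite ltxx scale0r.
Qed.

(* A direction pointing from [x] into [K] moves weight away from the vertices
   in any representation [S] of [x], towards vertices of [K]. *)
Lemma conic_hull_transfer K S x r : injective a -> face (conv_hull A) K ->
  Sx (K `&` A) x S -> conic_hull [set y - x | y in K] r ->
  exists al : 'I_n -> R, [/\ \sum_i al i = 0, r = \sum_i al i *: a i,
    forall i, 0 < al i -> K (a i) & forall i, al i < 0 -> S (a i)].
Proof.
move=> ainj fK [SKA [_ [c [c0 c1 xE]]]] [m [b [k [bK k0 ->]]]].
have SA : S `<=` A by move=> v /SKA[].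
pose be i := if a i \in S then c (a i) else 0.
have be1 : \sum_i be i = 1 by rewrite -fsbig_range_inj.
have xbe : x = \sum_i be i *: a i.
  rewrite xE fsbig_range_inj//; apply: eq_bigr => i _; rewrite /be.
  by case: ifP => //; rewrite scale0r.
(* The property is stable under sums, so one generator [k l *: (y - x)] can be treated at a time. *)
apply: (big_ind (fun r => exists al : 'I_n -> R,
  [/\ \sum_i al i = 0, r = \sum_i al i *: a i,
    forall i, 0 < al i -> K (a i) & forall i, al i < 0 -> S (a i)])).
- exists (fun=> 0); split; [by rewrite big1| |by move=> i; rewrite ltxx..].
  by rewrite big1// => i _; rewrite scale0r.
- move=> _ _ [al [al0 -> alK alS]] [bt [bt0 -> btK btS]].
  exists (fun i => al i + bt i); split.
  + by rewrite big_split/= al0 bt0 addr0.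
  + by rewrite -big_split; apply: eq_bigr => i _; rewrite scalerDl.
  + move=> i; have [/alK//|ali] := ltP 0 (al i).
    by have [/btK//|bti] := ltP 0 (bt i); lra.
  + move=> i; have [/alS//|ali] := ltP (al i) 0.
    by have [/btS//|bti] := ltP (bt i) 0; lra.
- move=> l _; have [y Ky <-] := bK l.
  have [g [g0 g1 yE]] : exists g : 'I_n -> R,
      [/\ forall i, 0 <= g i, \sum_i g i = 1 & y = \sum_i g i *: a i].
    by apply: conv_hull_range; case: fK Ky => ? [? [_ ->]] [].
  (* A positive coefficient forces [g i > 0], and [mem_face] puts [a i] in [K]; a negative one
     forces [be i] to be nonzero, so [a i] lies in [S]. *)
  exists (fun i => k l * (g i - be i)); split.
  + by rewrite -mulr_sumr sumrB g1 be1 subrr mulr0.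
  + rewrite yE xbe -sumrB scaler_sumr; apply: eq_bigr => i _.
    by rewrite -scalerBl scalerA.
  + have bei i : 0 <= be i.
      by rewrite /be; case: ifPn => // /[!inE] /c0/ltW.
    move=> i kgb; apply: (mem_face K g fK g0 g1); first by rewrite -yE.
    rewrite lt_neqAle g0 andbT; apply: contraTN kgb => /eqP <-.
    by rewrite -leNgt sub0r mulrN oppr_le0 mulr_ge0.
  + move=> i; rewrite /be; case: ifPn => [/[!inE]//|_].
    by rewrite subr0 ltNge mulr_ge0.
Qed.

End simplex.

Section width.
Context {R : realType} {d n : nat} (a : 'I_n -> 'rV[R]_d) (e : R).
Hypotheses (e0 : 0 < e) (hae : heights_ge a e).

Let A : set 'rV[R]_d := [set a i | i in [set: 'I_n]].

(* With [p], [q] the positive and negative parts of [al] and [M] their common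
   mass, [M |r|^2] is the average of [<r, a_i - a_j>] against [p_i q_j], and
   [e M <= n |r|] by the height condition. *)
Lemma transfer_width (al : 'I_n -> R) r tau : \sum_i al i = 0 ->
  r = \sum_i al i *: a i -> r != 0 ->
  (forall i j, 0 < al i -> al j < 0 -> dot r (a i - a j) <= tau) ->
  e * enorm r <= n%:R * tau.
Proof.
move=> al0 rE r0 rtau.
pose p i := Num.max (al i) 0; pose q i := Num.max (- al i) 0.
have p0 i : 0 <= p i by rewrite /p le_max lexx orbT.
have q0 i : 0 <= q i by rewrite /q le_max lexx orbT.
have alE i : al i = p i - q i by rewrite /p /q /Num.max; do 2 case: ifPn; lra.
pose M := \sum_i p i.
have qM : \sum_i q i = M.
  apply/esym/eqP; rewrite -subr_eq0 -sumrB -[X in _ == X]al0; apply/eqP.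
  by apply: eq_bigr => i _; rewrite alE.
have pal i : p i <= `|al i|.
  by rewrite /p ge_max ler_norm normr_ge0.
have eM : e * M <= n%:R * enorm r.
  rewrite /M mulr_sumr [leRHS]mulr_natl -[n in leRHS]card_ord -sumr_const.
  apply: ler_sum => i _; rewrite rE (le_trans _ (hae _ al0 i))//.
  by rewrite ler_pM2l.
(* If [M] were 0, then [p] and [q] would both vanish, and so would [r]. *)
have M0 : 0 < M.
  rewrite lt_def sumr_ge0// andbT; apply: contra_neq r0 => M0.
  rewrite rE big1// => i _; rewrite alE.
  have /psumr_eq0P -> // := M0; rewrite -qM in M0.
  by have /psumr_eq0P -> // := M0; rewrite subrr scale0r.
have rr : dot r r = \sum_i p i * dot r (a i) - \sum_i q i * dot r (a i).
  rewrite {2}rE dot_sumr -sumrB; apply: eq_bigr => i _.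
  by rewrite dotZr alE mulrBl.
have : M * dot r r <= tau * M ^+ 2.
  have -> : M * dot r r = \sum_i \sum_j p i * q j * dot r (a i - a j).
    under eq_bigr => i _.
      under eq_bigr do rewrite dotBr mulrBr -mulrA mulrCA -!mulrA.
      rewrite sumrB -mulr_suml -!mulr_sumr qM; over.
    by rewrite sumrB -mulr_sumr -mulr_suml -mulrBr -rr.
  have -> : tau * M ^+ 2 = \sum_i \sum_j p i * q j * tau.
    under eq_bigr => i _ do rewrite -mulr_suml -mulr_sumr qM.
    by rewrite -2!mulr_suml -/M mulrC expr2.
  apply: ler_sum => i _; apply: ler_sum => j _.
  have [ali|ali] := ltP 0 (al i); last by rewrite {1 2}/p max_r// !mul0r.
  have [alj|alj] := ltP (al j) 0; last by rewrite /q max_r ?oppr_le0// mulr0 !mul0r.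
  by rewrite ler_wpM2l ?mulr_ge0// rtau.
(* Cancelling [M] leaves [dot r r <= tau * M]. Then [e |r|^2 <= tau e M <= tau n |r|], where the
   second inequality uses [0 <= tau], and [|r|] cancels. *)
rewrite expr2 mulrCA ler_pM2l// => rtauM.
have nr : 0 < enorm r by rewrite enorm_gt0.
rewrite -(ler_pM2r nr) -mulrA -expr2 sqr_enorm.
rewrite (le_trans (ler_wpM2l (ltW e0) rtauM))//.
have tau0 : 0 <= tau.
  by rewrite -(pmulr_lge0 _ M0) (le_trans _ rtauM)// dot_ge0.
by rewrite mulrCA mulrC (mulrC _ (enorm r)) mulrA (mulrC (enorm r)) ler_wpM2r.
Qed.

Lemma PDirW_ge K r x : face (conv_hull A) K -> K x ->
  conic_hull [set y - x | y in K] r -> r != 0 -> e / n%:R <= PDirW (K `&` A) r x.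
Proof.
move=> fK Kx rK r0; have ainj := heights_ge_inj a e e0 hae.
have [g [g0 g1 xE]] : exists g : 'I_n -> R,
    [/\ forall i, 0 <= g i, \sum_i g i = 1 & x = \sum_i g i *: a i].
  by apply: conv_hull_range; case: fK Kx => ? [? [_ ->]] [].
have n0 : (0 < n)%N.
  rewrite lt0n; apply: contra_eq_neq g1 => n0.
  by rewrite big1 1?eq_sym ?oner_eq0// => -[i i0]; exfalso; rewrite n0 in i0.
have nr : 0 < enorm r by rewrite enorm_gt0.
apply: lb_le_inf.
  have [S xS] : Sx (K `&` A) x !=set0.
    apply: (Sx_nonempty a _ _ g) => // i gi.
    split; last by exists i.
    by apply: (mem_face a K g) => //; rewrite -xE.
  by eexists; exists S.
move=> _ [S xS <-].
have [al [al0 rE alK alS]] := conic_hull_transfer a K S x r ainj fK xS rK.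
set E := [set _ | _ in _ & _ in _].
(* [sup] dominates its elements only for a bounded set; the sum of all pairwise absolute values is a
   crude bound. *)
have Eub : has_ubound E.
  exists (\sum_i \sum_j `|dot ((enorm r)^-1 *: r) (a i - a j)|).
  move=> _ [_ [_ [i _ <-]] [v Sv <-]].
  have [_ [j _ <-]] : (K `&` A) v by case: xS => /(_ _ Sv).
  rewrite (bigD1 i)//= (bigD1 j)//= -addrA (le_trans (ler_norm _))// lerDl.
  by rewrite addr_ge0 ?sumr_ge0// => k _; rewrite sumr_ge0.
have /(transfer_width al r (sup E * enorm r) al0 rE r0) :
    forall i j, 0 < al i -> al j < 0 -> dot r (a i - a j) <= sup E * enorm r.
  move=> i j ali alj; rewrite -ler_pdivrMr// mulrC -dotZl.
  apply: ub_le_sup => //; exists (a i); first by split; [exact: alK|exists i].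
  by exists (a j) => //; exact: alS.
by rewrite mulrA ler_pM2r// ler_pdivrMr ?ltr0n// mulrC.
Qed.

Lemma PWidth_ge : (1 < n)%N -> e / n%:R <= PWidth A.
Proof.
move=> n1; apply: lb_le_inf; last by move=> _ [K [x [r [? ? ? ? ->]]]]; exact: PDirW_ge.
have ainj := heights_ge_inj a e e0 hae.
pose i : 'I_n := Ordinal (ltnW n1); pose j : 'I_n := Ordinal n1.
have aA k : conv_hull A (a k).
  exists 1, (fun=> a k), (fun=> 1); split=> //; rewrite ?big_ord1 ?scale1r//.
  by move=> _; exists k.
(* The infimum of an empty set would be 0, so one width is exhibited: the whole hull as a face, cut
   out by [0 <= 0], with the direction from one vertex to another. *)
exists (PDirW (conv_hull A `&` A) (a j - a i) (a i)).
exists (conv_hull A), (a i), (a j - a i); split => //.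
- exists 0, 0; have dot00 x : dot 0 x = 0 :> R by rewrite dotC dot0r.
  by split=> [x _|]; [rewrite dot00|apply/seteqP; split => x; [split => //=; rewrite dot00|case]].
- exists 1, (fun=> a j - a i), (fun=> 1); split=> //; rewrite ?big_ord1 ?scale1r//.
  by move=> _; exists (a j).
- by rewrite subr_eq0 (inj_eq ainj).
Qed.

Lemma kappa_ge D : (1 < n)%N -> (forall i j, enorm (a i - a j) <= D) ->
  e / n%:R / D <= kappa A.
Proof.
move=> n1 aD.
pose i : 'I_n := Ordinal (ltnW n1); pose j : 'I_n := Ordinal n1.
have Eub : ubound [set enorm (x - y) | x in A & y in A] D.
  by move=> _ [_ [k _ <-] [_ [l _ <-] <-]].
have dE k l : enorm (a k - a l) <= diam A.
  apply: ub_le_sup; first by exists D.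
  by exists (a k); [exists k|exists (a l) => //; exists l].
have diam0 : 0 < diam A.
  by rewrite (lt_le_trans e0)// (le_trans _ (dE i j))// (heights_ge_dist a e).
have diamD : diam A <= D.
  apply: ge_sup => //; exists (enorm (a i - a i)), (a i); first by exists i.
  by exists (a i) => //; exists i.
have D0 := lt_le_trans diam0 diamD.
by rewrite ler_pM ?invr_ge0 ?divr_ge0 ?(ltW e0) ?(ltW D0)// ?PWidth_ge// lef_pV2.
Qed.

End width.

(** * Heights and hyperplanes *)

(** The projection onto coefficient vectors of sum 0. Rational approximations of a zero-sum vector
    need not sum to 0; centering restores this at the cost of a small perturbation. *)
Definition centered {R : numFieldType} {n : nat} (c : 'I_n -> R) (i : 'I_n) : R :=
  c i - (\sum_j c j) / n%:R.

Lemma sum_centered {R : numFieldType} n (c : 'I_n -> R) :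
  \sum_i centered c i = 0.
Proof.
rewrite sumrB sumr_const card_ord; case: n c => [|n] c.
  by rewrite big_ord0 mulr0n subrr.
by rewrite -[X in _ - X]mulr_natr divfK ?subrr// pnatr_eq0.
Qed.

(** Both sides of the height inequality are continuous in the coefficients, so a countable dense
    family of zero-sum vectors suffices. *)
Lemma heights_ge_rat {R : realType} d n (a : 'I_n -> 'rV[R]_d) (e : R) : 0 <= e ->
  (forall (q : {ffun 'I_n -> rat}) i,
    let c := centered (fun j => ratr (q j) : R) in
    e * `|c i| <= enorm (\sum_j c j *: a j)) ->
  heights_ge a e.
Proof.
move=> e0 H al al0 i; apply/ler_addgt0Pr => eta eta0.
(* Centering an [h]-approximation moves each coefficient by at most [2 * h], half from the
   approximation and half from the mean. The two sides then move by at most [2 * h * e] and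
   [2 * h * \sum_j enorm (a j)]; the final 1 keeps [C] positive. *)
pose C := 2 * (\sum_j enorm (a j) + e) + 1.
have C0 : 0 < C.
  by rewrite ltr_wpDl// mulr_ge0// addr_ge0// sumr_ge0// => j _; exact: enorm_ge0.
pose h := eta / C; have h0 : 0 < h by rewrite divr_gt0.
have /choice[q0 qal] : forall j, exists q : rat, `|ratr q - al j| < h.
  move=> j; have /rat_in_itvoo[q] : al j - h < al j + h by lra.
  by rewrite in_itv/= => qj; exists q; rewrite ltr_distl.
pose q := [ffun j => q0 j].
pose c := centered (fun j => ratr (q j) : R).
have n0 : 0 < n%:R :> R by rewrite ltr0n (leq_ltn_trans _ (ltn_ord i)).
have cal j : `|c j - al j| <= 2 * h.
  rewrite /c /centered addrAC (le_trans (ler_normB _ _))//.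
  rewrite mulr2n mulrDl mul1r; apply: lerD; first by rewrite ffunE ltW.
  have -> : \sum_k ratr (q k) = \sum_k (ratr (q k) - al k) :> R by rewrite sumrB al0 subr0.
  rewrite normrM normfV (ger0_norm (ltW n0)) ler_pdivrMr//.
  rewrite (le_trans (ler_norm_sum _ _ _))// mulr_natr -[X in _ *+ X]card_ord -sumr_const.
  by apply: ler_sum => k _; rewrite ffunE ltW.
have eal : e * `|al i| <= e * `|c i| + e * (2 * h).
  rewrite -mulrDr ler_wpM2l// -lerBlDl.
  have := cal i; rewrite distrC; apply: le_trans; exact: lerB_dist.
have ca : enorm (\sum_j c j *: a j) <=
    enorm (\sum_j al j *: a j) + (2 * h) * \sum_j enorm (a j).
  have -> : \sum_j c j *: a j = \sum_j al j *: a j + \sum_j (c j - al j) *: a j.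
    by rewrite -big_split; apply: eq_bigr => j _; rewrite /= -scalerDl subrKC.
  rewrite (le_trans (enormD _ _))// lerD2l (le_trans (enorm_sum _ _))// mulr_sumr.
  by apply: ler_sum => j _; rewrite enormZ ler_wpM2r ?enorm_ge0.
have -> : eta = h * C by rewrite /h divfK// gt_eqF.
have := H q i; rewrite -/c /C => Hc.
have hE : h * (2 * (\sum_j enorm (a j) + e) + 1) =
  (2 * h) * (\sum_j enorm (a j)) + e * (2 * h) + h by ring.
by rewrite hE; lra.
Qed.

(* A hyperplane containing all the [a_j] with [j <> i] separates [a_i] from
   them; the distance to it is at most the height at [i]. *)
Lemma hyperplane_through {R : realType} d (i : 'I_d.+1) (a : 'I_d.+1 -> 'rV[R]_d) :
  (0 < d)%N ->
  exists u b, dot u u = 1 /\ forall j, j != i -> dot u (a j) = b.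
Proof.
move=> d0.
(* A row vector [(w, b)] in the left kernel satisfies [dot w (a j) = b] for all [j != i]; with
   [d + 1] rows and [d] columns the kernel is nonzero. *)
pose N : 'M[R]_(d + 1, d) := col_mx (\matrix_(k, j) a (lift i j) 0 k) (const_mx (-1)).
have /rowV0Pn[v /sub_kermxP vN v0] : kermx N != 0.
  rewrite -mxrank_eq0 mxrank_ker subn_eq0 -ltnNge.
  by rewrite (leq_ltn_trans (rank_leq_col _))// addn1.
pose w := lsubmx v; pose r := rsubmx v; pose b := r 0 0.
have wa j : dot w (a (lift i j)) = b.
  have := congr1 (fun M : 'rV_d => M 0 j) vN; rewrite -[v in v *m _]hsubmxK.
  rewrite mul_row_col -/w -/r !mxE big_ord1 [const_mx _ _ _]mxE mulrN1 => /eqP.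
  rewrite subr_eq0 => /eqP; rewrite -/b => <-; apply: eq_bigr => k _.
  by congr (_ * _); rewrite [RHS]mxE.
have w0 : w != 0.
  apply: contra_neq v0 => w0.
  (* Since [d > 0], there is a point among the others to evaluate at, so [w = 0] would force [b = 0]
     as well. *)
  have b0 : b = 0 by rewrite -(wa (Ordinal d0)) w0 dotC dot0r.
  rewrite -[v]hsubmxK -/w -/r w0; suff -> : r = 0 by rewrite row_mx0.
  by apply/rowP => k; rewrite ord1 -/b b0 mxE.
exists ((enorm w)^-1 *: w), ((enorm w)^-1 * b); split.
  by rewrite dotZl dotZr -sqr_enorm expr2 mulKf ?mulVf// gt_eqF// enorm_gt0.
by move=> j; rewrite eq_sym => /unlift_some[k -> _]; rewrite dotZl wa.
Qed.

(** Pairing the zero-sum combination with [u] cancels [b] and every term but the [i]-th, leaving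
    [c i] times the signed distance from [a i] to the hyperplane; Cauchy-Schwarz with the unit
    vector [u] concludes. *)
Lemma dist_hyperplane_lt {R : realType} d n (i : 'I_n) (a : 'I_n -> 'rV[R]_d)
    (c : 'I_n -> R) e u b :
  dot u u = 1 -> (forall j, j != i -> dot u (a j) = b) -> \sum_j c j = 0 ->
  enorm (\sum_j c j *: a j) < e * `|c i| -> `|dot u (a i) - b| < e.
Proof.
move=> u1 ub c0 cae.
have uE : dot u (\sum_j c j *: a j) = c i * (dot u (a i) - b).
  transitivity (\sum_j c j * (dot u (a j) - b)).
    under [RHS]eq_bigr do rewrite mulrBr.
    rewrite sumrB -mulr_suml c0 mul0r subr0 dot_sumr.
    by apply: eq_bigr => j _; rewrite dotZr.
  rewrite (bigD1 i)//= big1 ?addr0// => j ji.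
  by rewrite ub// subrr mulr0.
have [ci0|ci0] := eqVneq (c i) 0.
  by rewrite ci0 normr0 mulr0 ltNge enorm_ge0 in cae.
have enu : enorm u = 1 by rewrite /enorm u1 sqrtr1.
rewrite -(@ltr_pM2l _ `|c i|) ?normr_gt0// -normrM -uE mulrC.
by rewrite (le_lt_trans (dot_le_enorm _ _))// enu mul1r.
Qed.

(** * Gaussian estimates *)

Section normal_bounds.
Context {R : realType}.
Implicit Types m s b e : R.
Local Notation mu := (@lebesgue_measure R).

(** The Radon-Nikodym derivative of the normal law agrees almost everywhere with the density, since
    both have the same integral over every measurable set. *)
Lemma ge0_integral_normal_prob m s (f : R -> \bar R) :
  measurable_fun setT f -> (forall x, 0 <= f x)%E ->
  (\int[normal_prob m s]_x f x = \int[mu]_x (f x * (normal_pdf m s x)%:E))%E.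
Proof.
move=> mf f0; have dom := normal_prob_dominates m s.
rewrite -(Radon_Nikodym_SigmaFinite.change_of_variables dom)//.
have RNi := Radon_Nikodym_SigmaFinite.f_integrable dom.
have mpdf : measurable_fun setT (EFin \o normal_pdf m s).
  by apply/measurable_EFinP; exact: measurable_normal_pdf.
apply: ae_eq_integral => //.
- by apply: emeasurable_funM => //; exact: measurable_int RNi.
- exact: emeasurable_funM.
- apply: ae_eqe_mul2l; apply: integral_ae_eq => //.
  by move=> E _ mE; rewrite -Radon_Nikodym_SigmaFinite.f_integral.
Qed.

(* [t <= exp t] trades the factor [(x - m)^2] for a doubled deviation. *)
Lemma sqr_normal_pdf_le m s x : 0 < s ->
  (x - m) ^+ 2 * normal_pdf m s x <= 6 * s ^+ 2 * normal_pdf m (2 * s) x.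
Proof.
move=> s0; have s20 : 0 < 2 * s by rewrite mulr_gt0.
rewrite !normal_pdfE ?gt_eqF//.
have -> : normal_peak (2 * s) = normal_peak s / 2.
  rewrite /normal_peak exprMn -mulrA -mulrnAr sqrtrM ?sqr_ge0// sqrtr_sqr.
  by rewrite ger0_norm// invfM mulrC.
rewrite /=.
have p0 : 0 < normal_peak s by rewrite normal_peak_gt0 ?gt_eqF.
rewrite [leLHS](_ : _ = normal_peak s * ((x - m) ^+ 2 * normal_fun m s x)); last first.
  by rewrite mulrCA.
rewrite [leRHS](_ : _ = normal_peak s * (3 * s ^+ 2 * normal_fun m (2 * s) x)); last first.
  by rewrite -!mulrA; field.
rewrite ler_pM2l// /normal_fun.
set t := (x - m) ^+ 2; have t0 : 0 <= t := sqr_ge0 _.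
have s2 : 0 < s ^+ 2 by rewrite exprn_gt0.
(* [k] is the difference of the exponents, [t / (2 s^2) - t / (8 s^2)]. Then
   [t = 8/3 s^2 k <= 3 s^2 exp k], and the halved peak at deviation [2 * s] turns 3 into 6. *)
pose k := 3 / 8 * (t / s ^+ 2).
have -> : - t / ((2 * s) ^+ 2 *+ 2) = - t / (s ^+ 2 *+ 2) + k.
  by rewrite /k -[(2 * s) ^+ 2 *+ 2]mulr_natr -[s ^+ 2 *+ 2]mulr_natr; field; rewrite gt_eqF.
rewrite expRD mulrCA [leLHS]mulrC ler_pM2l ?expR_gt0//.
have : k <= expR k by rewrite (le_trans _ (expR_ge1Dx k))// lerDr.
have -> : t = 8 / 3 * s ^+ 2 * k by rewrite /k; field; rewrite gt_eqF.
move=> kexp.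
have : s ^+ 2 * k <= s ^+ 2 * expR k by rewrite ler_pM2l.
have : 0 <= s ^+ 2 * expR k by rewrite mulr_ge0 ?expR_ge0 ?ltW.
lra.
Qed.

Lemma normal_second_moment m s : 0 < s ->
  (\int[normal_prob m s]_x ((x - m) ^+ 2)%:E <= (6 * s ^+ 2)%:E)%E.
Proof.
move=> s0.
have mf : measurable_fun setT (fun x : measurableTypeR R => (x - m) ^+ 2).
  by apply: measurable_funX; exact: measurable_funB.
rewrite ge0_integral_normal_prob; last 2 first.
- exact/measurable_EFinP.
- by move=> x; rewrite lee_fin sqr_ge0.
apply: (@le_trans _ _ (\int[mu]_x ((6 * s ^+ 2)%:E * (normal_pdf m (2 * s) x)%:E))%E).
  apply: ge0_le_integral => //.
  - by move=> x _; rewrite -EFinM lee_fin mulr_ge0 ?sqr_ge0 ?normal_pdf_ge0.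
  - apply: emeasurable_funM; first exact/measurable_EFinP.
    by apply/measurable_EFinP; exact: measurable_normal_pdf.
  - by apply: measurable_funeM; apply/measurable_EFinP; exact: measurable_normal_pdf.
  - by move=> x _; rewrite -!EFinM lee_fin sqr_normal_pdf_le.
rewrite integralZl//; last exact: integrable_normal_pdf.
by rewrite integral_normal_pdf mule1.
Qed.

Lemma abs_sub_lt_itv b e : [set x : R | `|x - b| < e] = `]b - e, b + e[%classic.
Proof. by apply/seteqP; split => x; rewrite /= in_itv/= ltr_distl. Qed.

(** The density is at most its peak [1 / (s sqrt (2 pi))], the interval has length [2 e], and
    [2 <= sqrt (2 pi)]. *)
Lemma normal_prob_small_ball m s b e : 0 < s -> 0 <= e ->
  (normal_prob m s [set x | `|x - b| < e]%R <= (e / s)%:E)%E.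
Proof.
move=> s0 e0.
pose I : set R := `]b - e, b + e[%classic.
rewrite abs_sub_lt_itv -/I.
rewrite /normal_prob.
apply: (@le_trans _ _ (\int[mu]_(x in I) (normal_peak s)%:E)%E).
  apply: ge0_le_integral => //; first exact: measurable_itv.
  - by move=> x _; rewrite lee_fin normal_pdf_ge0.
  - by apply/measurable_EFinP/measurable_funTS; exact: measurable_normal_pdf.
  - by move=> x _; rewrite lee_fin normal_pdf_ub ?gt_eqF.
have mI : measurable I by exact: measurable_itv.
rewrite integral_cst//= lebesgue_measure_itv/= lte_fin.
have s_peak : normal_peak s * 2 <= s^-1.
  have pi2 := pi_ge2 R; have pi0 : 0 <= pi *+ 2 :> R by rewrite mulrn_wge0// pi_ge0.
  rewrite /normal_peak -mulrnAr sqrtrM ?sqr_ge0// sqrtr_sqr gtr0_norm//.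
  rewrite invfM -mulrA; apply: ler_piMr; first by rewrite invr_ge0 ltW.
  have sq2 : 2 <= Num.sqrt (pi *+ 2) :> R.
    rewrite -(@ler_pXn2r _ 2) ?nnegrE ?sqrtr_ge0// (sqr_sqrtr pi0).
    by rewrite -[pi *+ 2]mulr_natr expr2; lra.
  by rewrite mulrC ler_pdivrMr ?mul1r// (lt_le_trans _ sq2).
case: ifPn => [_|_]; last by rewrite mule0 lee_fin divr_ge0// ltW.
rewrite -EFinD -EFinM lee_fin.
rewrite [leLHS](_ : _ = e * (normal_peak s * 2)); last by ring.
by rewrite ler_wpM2l.
Qed.

End normal_bounds.

Section borel.
Context {R : realType} {d : nat}.

Lemma measurable_borel_coord (j : 'I_d) :
  measurable_fun setT (fun v : g_sigma_algebraType (@open 'rV[R]_d) => v 0 j).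
Proof.
apply: (measurability _ (RGenOpens.measurableE R)) => _ [_ [x [y ->]] <-].
rewrite setTI; apply: sub_sigma_algebra.
have /continuousP := @coord_continuous R 1 d 0 j.
by apply; exact: interval_open.
Qed.

Lemma measurable_dot {dT} {T : measurableType dT} (u : 'rV[R]_d) (X : T -> 'rV[R]_d) :
  (forall j, measurable_fun setT (fun t => X t 0 j)) ->
  measurable_fun setT (fun t => dot u (X t)).
Proof.
by move=> mX; apply: measurable_sum => j; exact: measurable_funM.
Qed.

End borel.

Section gaussian_law.
Context {dT : measure_display} {T : measurableType dT} {R : realType}.
Variables (P : probability T R) (Y : T -> R) (m s : R).
Hypotheses (mY : measurable_fun setT Y) (s0 : 0 <= s).
Hypothesis lawY : forall B : set R, measurable B ->
  P (Y @^-1` B) = gaussian_law m s B.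

(** The integral is transported to the law of [Y]; in the degenerate case this law is the Dirac mass
    at [m] and the integral is 0. *)
Lemma gaussian_law_second_moment :
  (\int[P]_t ((Y t - m) ^+ 2)%:E <= (6 * s ^+ 2)%:E)%E.
Proof.
pose f (x : R) := ((x - m) ^+ 2)%:E.
have mf : @measurable_fun _ _ (measurableTypeR R) _ setT f.
  by apply/measurable_EFinP; apply: measurable_funX; exact: measurable_funB.
have f0 x : (0 <= f x)%E by rewrite lee_fin sqr_ge0.
have mY' : @measurable_fun _ _ T (measurableTypeR R) setT Y by exact: mY.
pose YM : {RV P >-> measurableTypeR R} := @mfun_Sub _ _ T (measurableTypeR R) Y (mem_set mY').
rewrite -[leLHS](ge0_integral_distribution YM mf f0).
have [s_eq0|s_neq0] := eqVneq s 0; last first.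
  rewrite (eq_measure_integral (normal_prob m s)) => [|B mB _].
    by apply: normal_second_moment; rewrite lt_def s_neq0.
  by have := lawY B mB; rewrite /gaussian_law (negbTE s_neq0).
rewrite (eq_measure_integral (@dirac _ (measurableTypeR R) m R)) => [|B mB _].
  by rewrite integral_dirac// diracT mul1e /f subrr expr0n/= lee_fin mulr_ge0 ?sqr_ge0.
by have := lawY B mB; rewrite /gaussian_law s_eq0 eqxx.
Qed.

Lemma gaussian_law_Lfun2 : Y \in Lfun P 2%:E.
Proof.
have mYm : measurable_fun setT (fun t => Y t - m) by exact: measurable_funB.
have L2 : (fun t => Y t - m) \in Lfun P 2%:E.
  rewrite inE; apply/andP; split; rewrite inE//=.
  rewrite /finite_norm unlock/= poweR_lty//.
  apply: le_lt_trans (ltry (6 * s ^+ 2)).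
  rewrite (le_trans _ gaussian_law_second_moment)//.
  rewrite le_eqVlt; apply/orP; left; apply/eqP; apply: eq_integral => t _ /=.
  by rewrite powR_mulrn// real_normK// num_real.
have -> : Y = (fun t => Y t - m) \+ cst m by apply/funext => t /=; rewrite subrK.
by rewrite rpredD ?lee1n//= Lfun_cst.
Qed.

(** Translation by [m] preserves the variance, and a variance is at most the second moment; the mean
    of [Y] is never computed. *)
Lemma variance_gaussian_law_le : ('V_P[Y] <= (6 * s ^+ 2)%:E)%E.
Proof.
have Y2 := gaussian_law_Lfun2.
rewrite -(varianceB_cst_r m Y2) varianceE; last first.
  by rewrite rpredB ?lee1n//= Lfun_cst.
apply: le_trans gaussian_law_second_moment.
rewrite [in leRHS](_ : (\int[P]_t _)%E = 'E_P[(Y \- cst m) ^+ 2]%E); last by rewrite unlock.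
by rewrite -[leRHS]sube0 leeB// sqre_ge0.
Qed.

Lemma gaussian_law_small_ball b e : 0 < s -> 0 <= e ->
  (P [set t | `|Y t - b| < e]%R <= (e / s)%:E)%E.
Proof.
move=> s_gt0 e0.
have mB : measurable [set x : R | `|x - b| < e].
  by rewrite abs_sub_lt_itv; exact: measurable_itv.
have := lawY _ mB; rewrite /gaussian_law gt_eqF// => ->.
exact: normal_prob_small_ball.
Qed.

End gaussian_law.

Section covariance_sum.
Context {dT : measure_display} {T : measurableType dT} {R : realType}.
Variables (P : probability T R) (I : Type) (F : I -> T -> R).
Hypothesis F2 : forall i, F i \in Lfun P 2%:E.

Lemma Lfun2_sum (r : seq I) : (fun t => \sum_(i <- r) F i t) \in Lfun P 2%:E.
Proof.
elim: r => [|i r r2].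
  have -> : (fun t => \sum_(i <- [::]) F i t) = cst 0 :> (T -> R).
    by apply/funext => t; rewrite big_nil.
  by rewrite Lfun_cst.
have -> : (fun t => \sum_(j <- i :: r) F j t) =
    F i \+ (fun t => \sum_(j <- r) F j t).
  by apply/funext => t; rewrite big_cons.
by rewrite rpredD ?lee1n.
Qed.

Lemma covariance_suml (r : seq I) (Z : T -> R) : Z \in Lfun P 2%:E ->
  covariance P (fun t => \sum_(i <- r) F i t)%R Z = (\sum_(i <- r) covariance P (F i) Z)%E.
Proof.
move=> Z2; elim: r => [|i r IH].
  have -> : (fun t => \sum_(i <- [::]) F i t) = cst 0 :> (T -> R).
    by apply/funext => t; rewrite big_nil.
  by rewrite big_nil covariance_cst_l.
have -> : (fun t => \sum_(j <- i :: r) F j t) =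
    F i \+ (fun t => \sum_(j <- r) F j t).
  by apply/funext => t; rewrite big_cons.
by rewrite covarianceDl ?Lfun2_sum// IH big_cons.
Qed.

End covariance_sum.

Section gaussian_vector.
Context {dT : measure_display} {T : measurableType dT} {R : realType} {d : nat}.
Variables (P : probability T R) (X : T -> 'rV[R]_d).
Hypothesis GX : gaussian_vector P X.

Lemma measurable_coord j : measurable_fun setT (fun t => X t 0 j).
Proof.
case: GX => rX _.
move=> _ B mB; rewrite setTI; apply: (rX [set v : 'rV[R]_d | B (v 0 j)]).
by have := measurable_borel_coord j measurableT _ mB; rewrite setTI.
Qed.

Lemma measurable_dot_gaussian u : measurable_fun setT (fun t => dot u (X t)).
Proof. by apply: measurable_dot => j; exact: measurable_coord. Qed.

Lemma coord_Lfun2 j : Defs.coord X j \in Lfun P 2%:E.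
Proof.
have [_ /(_ (delta_mx 0 j))[m [s [s0 law]]]] := GX.
apply: (gaussian_law_Lfun2 P _ m s (measurable_coord j) s0) => B /law <-.
congr (P (_ @^-1` B)); apply/funext => t.
rewrite /Defs.coord /dot (bigD1 j)//= mxE !eqxx mul1r big1 ?addr0// => k kj.
by rewrite mxE eqxx (negbTE kj) mul0r.
Qed.

Lemma variance_dot sigma u : has_covariance P X ((sigma ^+ 2)%:M) ->
  'V_P[fun t => dot u (X t)]%E = (sigma ^+ 2 * dot u u)%:E.
Proof.
move=> covX.
have P_fin : P setT \is a fin_num := fin_num_measure P _ measurableT.
pose F j := u 0 j \o* Defs.coord X j.
have F2 j : F j \in Lfun P 2%:E by rewrite Lfun_scale ?ler1n ?coord_Lfun2.
have FE : (fun t => dot u (X t)) = (fun t => \sum_j F j t).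
  by apply/funext => t; apply: eq_bigr => j _; rewrite /F /= mulrC.
have S2 : (fun t => \sum_j F j t) \in Lfun P 2%:E by exact: Lfun2_sum.
have covF j k : covariance P (F j) (F k) = (u 0 j * (u 0 k * (sigma ^+ 2)%:M j k))%:E.
  have X1 i : Defs.coord X i \in Lfun P 1 by rewrite Lfun_subset12// coord_Lfun2.
  have F1 i : F i \in Lfun P 1 by rewrite Lfun_subset12.
  rewrite covarianceZl// ?covarianceZr// ?covX ?EFinM//.
  - by rewrite Lfun2_mul_Lfun1// coord_Lfun2.
  - by rewrite Lfun2_mul_Lfun1// coord_Lfun2.
rewrite FE /variance covariance_suml// mulr_sumr -sumEFin; apply: eq_bigr => j _.
rewrite covarianceC covariance_suml// (bigD1 j)//= covF mxE eqxx mulr1n.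
rewrite big1 ?adde0 => [|k kj]; last by rewrite covF mxE (negbTE kj) mulr0n !mulr0.
by rewrite mulrA mulrC.
Qed.

(** The definition of a Gaussian vector gives [dot u (X t)] some deviation [s]. Its variance is
    [sigma ^+ 2] by the covariance hypothesis and at most [6 * s ^+ 2], so [sigma <= 3 * s]; this
    also excludes the degenerate law. *)
Lemma gaussian_vector_small_ball sigma u b e : 0 < sigma -> 0 <= e ->
  has_covariance P X ((sigma ^+ 2)%:M) -> dot u u = 1 ->
  (P [set t | `|dot u (X t) - b| < e]%R <= (3 * e / sigma)%:E)%E.
Proof.
move=> sg0 e0 covX u1; have [_ /(_ u)[m [s [s0 law]]]] := GX.
have mY := measurable_dot_gaussian u.
have := variance_gaussian_law_le P _ m s mY s0 law.
rewrite (variance_dot sigma)// u1 mulr1 lee_fin => sg_s.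
have sg3s : sigma <= 3 * s.
  rewrite -(@ler_pXn2r _ 2) ?nnegrE ?mulr_ge0 ?(ltW sg0)// exprMn.
  by have := sqr_ge0 s; lra.
have s_gt0 : 0 < s by lra.
apply: (le_trans (gaussian_law_small_ball P _ m s law b e s_gt0 e0)).
by rewrite lee_fin ler_pdivrMr// mulrAC ler_pdivlMr//; nra.
Qed.

Lemma gaussian_vector_chebyshev sigma (mu : 'rV[R]_d) j l : 0 < l ->
  has_mean P X mu -> has_covariance P X ((sigma ^+ 2)%:M) ->
  (P [set t | l <= `|X t 0 j - mu 0 j|]%R <= (sigma ^+ 2 / l ^+ 2)%:E)%E.
Proof.
move=> l0 meanX covX.
pose Y : {RV P >-> R} := mfun_Sub (mem_set (measurable_coord j)).
have := chebyshev Y l0.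
have -> : 'E_P[Y]%E = (mu 0 j)%:E by exact: meanX.
have -> : 'V_P[Y]%E = (sigma ^+ 2)%:E.
  by rewrite [LHS](covX j j) mxE eqxx mulr1n.
by rewrite -EFinM mulrC.
Qed.

End gaussian_vector.

(** * Independence *)

(** Independence makes the joint law of [(U, V)] the product of the two laws, whose value on [G] is
    the integral of the measures of its sections. *)
Lemma measure_sections_le {R : realType} {dT d1 d2} {T : measurableType dT}
    {T1 : measurableType d1} {T2 : measurableType d2} (P : probability T R)
    (U : {mfun T >-> T1}) (V : {mfun T >-> T2}) (G : set (T1 * T2)) (c : R) :
  (forall A B, measurable A -> measurable B ->
    P (U @^-1` A `&` V @^-1` B) = P (U @^-1` A) * P (V @^-1` B))%E ->
  measurable G -> (forall x, P (V @^-1` xsection G x) <= c%:E)%E ->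
  (P [set t | G (U t, V t)] <= c%:E)%E.
Proof.
move=> indep mG Gc.
have mW : measurable_fun setT (fun t => (U t, V t)) by exact: measurable_fun_pair.
pose W : {mfun T >-> (T1 * T2)%type} := mfun_Sub (mem_set mW).
have <- : (distribution P U \x distribution P V)%E G = P [set t | G (U t, V t)].
  apply: (@product_measure_unique _ _ _ _ _ (distribution P U) (distribution P V)
    (distribution P W)) => //.
rewrite /product_measure1.
apply: (@le_trans _ _ (\int[distribution P U]_x (cst c%:E) x)%E).
  apply: ge0_le_integral => //.
  - exact: measurable_fun_xsection.
  - by move=> x _; exact: Gc.
by rewrite integral_cst//= probability_setT mule1.
Qed.

Section independence.
Context {dT : measure_display} {T : measurableType dT} {R : realType}.
Context {d : nat} {I : finType}.
Variables (P : probability T R) (X : I -> T -> 'rV[R]_d) (i : I).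
Hypotheses (rX : forall j, random_vector (X j)) (indX : independent_vectors P X).

(* They generate the sigma-algebra of the [X j] with [j <> i]; working with it
   on [T] itself avoids a product space indexed by those [j]. *)
Definition other_cylinders : set (set T) :=
  [set C | exists B : I -> set 'rV[R]_d, [/\ forall j, borel (B j), B i = setT &
    C = \bigcap_(j in [set: I]) (X j @^-1` B j)]].

Lemma measurable_cylinder (B : I -> set 'rV[R]_d) : (forall j, borel (B j)) ->
  measurable (\bigcap_(j in [set: I]) (X j @^-1` B j)).
Proof.
by move=> bB; apply: fin_bigcap_measurable => // j _; exact: rX.
Qed.

Lemma borelT : borel [set: 'rV[R]_d].
Proof. exact: (@measurableT _ (g_sigma_algebraType (@open 'rV[R]_d))). Qed.

Lemma other_cylinders_measurable C : <<s other_cylinders >> C -> measurable C.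
Proof.
apply: smallest_sub; first exact: sigma_algebra_measurable.
by move=> _ [B [bB _ ->]]; exact: measurable_cylinder.
Qed.

(** A pi-system argument: as functions of [C], both sides are finite measures that agree on the
    cylinders, which are stable under intersection and include the whole space. *)
Lemma independent_others C B : <<s other_cylinders >> C -> borel B ->
  (P (C `&` X i @^-1` B) = P C * P (X i @^-1` B))%E.
Proof.
move=> sC bB; have mXB := rX i B bB.
pose r : {nonneg R} := NngNum (fine_ge0 (measure_ge0 P (X i @^-1` B))).
have rE : (r%:num)%:E = P (X i @^-1` B) by rewrite fineK// fin_num_measure.
suff : mrestr P mXB C = mscale r P C.
  by rewrite /mrestr /mscale/= rE muleC.
apply: (g_sigma_algebra_measure_unique other_cylinders _ (fun=> setT)) => //.
- by move=> D sD; apply: other_cylinders_measurable; exact: sub_sigma_algebra.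
- move=> _; exists (fun=> setT); split => //; first by move=> _; exact: borelT.
  by rewrite bigcapT.
- by rewrite bigcup_const.
- move=> _ _ [B1 [b1 B1i ->]] [B2 [b2 B2i ->]].
  exists (fun j => B1 j `&` B2 j); split.
  + move=> j; apply: (@measurableI _ (g_sigma_algebraType (@open 'rV[R]_d))).
      exact: b1.
    exact: b2.
  + by rewrite B1i B2i setIT.
  + by rewrite -bigcapI.
- move=> _ [B1 [b1 B1i ->]].
  rewrite -[LHS]/(P (_ `&` X i @^-1` B)) -[RHS]/((r%:num)%:E * P _)%E rE.
  (* Intersecting with the event on [X i] only replaces the [i]-th factor, which was the whole space
     and had probability 1. *)
  pose B2 j := if j == i then B else B1 j.
  have b2 j : borel (B2 j) by rewrite /B2; case: ifP.
  have -> : \bigcap_(j in [set: I]) (X j @^-1` B1 j) `&` X i @^-1` B =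
      \bigcap_(j in [set: I]) (X j @^-1` B2 j).
    apply/seteqP; split => [t [tB1 tB] j _|t tB2].
      by rewrite /B2; case: eqP => [->//|_]; exact: tB1.
    split; last by have := tB2 i Logic.I; rewrite /B2 eqxx.
    move=> j _; have := tB2 j Logic.I; rewrite /B2; case: eqP => [-> _|//].
    by rewrite B1i.
  rewrite !indX// (bigD1 i)//= [in RHS](bigD1 i)//= /B2 eqxx B1i preimage_setT probability_setT.
  rewrite mul1e; congr (_ * _)%E; apply: eq_bigr => j /negbTE ->; by [].
- by move=> _; rewrite -[ltLHS]/(P (setT `&` X i @^-1` B)) setTI ltey_eq fin_num_measure.
Qed.

End independence.

(* Restricting to rational coefficients keeps the event a countable union. *)
Definition low_height {R : realType} {d n : nat} (a : 'I_n -> 'rV[R]_d) (i : 'I_n)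
    (e : R) : Prop :=
  exists q : {ffun 'I_n -> rat}, let c := centered (fun j => ratr (q j) : R) in
    enorm (\sum_j c j *: a j) < e * `|c i|.

Lemma heights_ge_not_low {R : realType} d n (a : 'I_n -> 'rV[R]_d) (e : R) :
  0 <= e -> (forall i, ~ low_height a i e) -> heights_ge a e.
Proof.
move=> e0 nlow; apply: heights_ge_rat => // q i /=; rewrite leNgt; apply/negP => low.
by apply: (nlow i); exists q.
Qed.

Lemma measurable_low_height {R : realType} {dT} {T : measurableType dT} d n
    (X : 'I_n -> T -> 'rV[R]_d) (i : 'I_n) (e : R) :
  (forall j k, measurable_fun setT (fun t => X j t 0 k)) ->
  measurable [set t | low_height (X^~ t) i e].
Proof.
move=> mX.
pose c (q : {ffun 'I_n -> rat}) := centered (fun j => ratr (q j) : R).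
pose S q := [set t | enorm (\sum_j c q j *: X j t) < e * `|c q i|].
have -> : [set t | low_height (X^~ t) i e] = \bigcup_(q in [set: {ffun 'I_n -> rat}]) S q.
  by apply/seteqP; split => t [q]; exists q.
apply: countable_bigcupT_measurable => [|q]; first exact: countableP.
have mN : measurable_fun setT (fun t => enorm (\sum_j c q j *: X j t)).
  have msqrt : measurable_fun setT (@Num.sqrt R).
    by apply: continuous_measurable_fun; exact: sqrt_continuous.
  apply: (measurableT_comp msqrt).
  apply: measurable_sum => k.
  have mk : measurable_fun setT (fun t => (\sum_j c q j *: X j t) 0 k).
    rewrite [X in measurable_fun _ X](_ : _ = fun t => \sum_j c q j * X j t 0 k).
      by apply: measurable_sum => j; exact: measurable_funM.
    by apply/funext => t; rewrite summxE; apply: eq_bigr => j _; rewrite mxE.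
  exact: measurable_funM.
have mc : @measurable_fun _ _ T R setT (cst (e * `|c q i|)) by exact: measurable_cst.
have mtrue : measurable [set true] by [].
have := measurable_fun_ltr mN mc measurableT mtrue.
by rewrite setTI.
Qed.

Section low_height_probability.
Context {dT : measure_display} {T : measurableType dT} {R : realType} {d : nat}.
Variables (P : probability T R) (X : 'I_d.+1 -> T -> 'rV[R]_d) (sigma : R).
Hypotheses (d0 : (0 < d)%N) (sigma0 : 0 < sigma).
Hypotheses (GX : forall j, gaussian_vector P (X j)).
Hypotheses (covX : forall j, has_covariance P (X j) ((sigma ^+ 2)%:M)).
Hypotheses (indX : independent_vectors P X).

Lemma low_height_probability i e : 0 <= e ->
  (P [set t | low_height (X^~ t) i e] <= (3 * e / sigma)%:E)%E.
Proof.
move=> e0; have rX j : random_vector (X j) by case: (GX j).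
(* [T1] is [T] with the sigma-algebra of the other points, so the identity map into it stands for
   those points in the product argument. *)
pose T1 := g_sigma_algebraType (other_cylinders X i).
pose T2 := g_sigma_algebraType (@open 'rV[R]_d).
have mU : @measurable_fun _ _ T T1 setT id.
  by move=> _ C mC; rewrite setTI; exact: (other_cylinders_measurable X i rX).
have mV : @measurable_fun _ _ T T2 setT (X i).
  by move=> _ B mB; rewrite setTI; exact: rX.
pose U : {mfun T >-> T1} := @mfun_Sub _ _ T T1 id (mem_set mU).
pose V : {mfun T >-> T2} := @mfun_Sub _ _ T T2 (X i) (mem_set mV).
(* [Z] rebuilds the configuration from a pair: the [i]-th point is the second component, the others
   are read off the first. *)
pose Z (j : 'I_d.+1) (z : T1 * T2) : 'rV[R]_d := if j == i then z.2 else X j z.1.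
pose G : set (T1 * T2) := [set z | low_height (Z^~ z) i e].
have mG : measurable G.
  apply: measurable_low_height => j k; rewrite /Z; case: eqP => [_|/eqP ji].
    exact: (measurableT_comp (measurable_borel_coord k) measurable_snd).
  have mXj : @measurable_fun _ _ T1 _ setT (fun t => X j t 0 k).
    move=> _ B mB; rewrite setTI; apply: sub_sigma_algebra.
    exists (fun l => if l == j then [set v : 'rV[R]_d | B (v 0 k)] else setT); split.
    + move=> l; case: ifP => _; last exact: borelT.
      by have := measurable_borel_coord k measurableT _ mB; rewrite setTI.
    + by rewrite eq_sym (negbTE ji).
    + apply/seteqP; split => [t Bt l _|t /(_ j Logic.I)]; last by rewrite eqxx.
      by case: ifPn => // /eqP ->.
  exact: (measurableT_comp mXj measurable_fst).
have -> : [set t | low_height (X^~ t) i e] = [set t | G (U t, V t)].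
  apply: eq_set => t; rewrite /G /=; congr (low_height _ i e); apply/funext => j.
  by rewrite /Z; case: eqP => [->|].
apply: (measure_sections_le P U V) => // [A B mA mB|t].
  exact: (independent_others P X i rX indX A B mA mB).
(* With [t] frozen, the other points and hence [u] and [b] are constants, and the section of [G]
   lies in a slab around the hyperplane. *)
have [u [b [u1 ub]]] := hyperplane_through d i (X^~ (t : T)) d0.
apply: le_trans (gaussian_vector_small_ball P (X i) (GX i) sigma u b e sigma0 e0 (covX i) u1).
apply: le_measure; rewrite ?inE.
- by have := measurable_xsection t mG; exact: rX.
- have mY := measurable_dot_gaussian P (X i) (GX i) u.
  have mB : measurable [set x : R | `|x - b| < e].
    by rewrite abs_sub_lt_itv; exact: measurable_itv.
  by have := mY measurableT _ mB; rewrite setTI.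
- move=> w /=; rewrite /xsection/= inE => -[q /= low].
  have -> : X i w = Z i (t, X i w) by rewrite /Z eqxx.
  apply: (dist_hyperplane_lt _ _ i (Z^~ (t, X i w)) _ e u b u1 _ _ low).
    by move=> j ji; rewrite /Z (negbTE ji) ub.
  exact: sum_centered.
Qed.

End low_height_probability.

(** * The probability bound *)

Lemma probability_bigsetU_le {R : realType} {dT} {T : measurableType dT}
    (P : probability T R) (I : finType) (F : I -> set T) (c : R) :
  (forall i, measurable (F i)) -> (forall i, P (F i) <= c%:E)%E ->
  measurable (\big[setU/set0]_i F i) /\
  (P (\big[setU/set0]_i F i) <= (#|I|%:R * c)%:E)%E.
Proof.
move=> mF Fc.
have -> : ((#|I|%:R * c)%:E = \sum_(i : I) c%:E)%E.
  by rewrite sumEFin sumr_const mulr_natl.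
apply: (big_rec2 (fun A s => measurable A /\ (P A <= s)%E)) => [|i A s _ [mA As]].
  by rewrite measure0.
split; first exact: measurableU.
apply: le_trans (measureU2 _ _ _) _ => //.
by apply: leeD => //; exact: Fc.
Qed.

Lemma sub_bigsetU {T : Type} (I : finType) (F : I -> set T) i :
  F i `<=` \big[setU/set0]_i F i.
Proof. by rewrite (bigD1 i)//=; exact: subsetUl. Qed.

Lemma enorm_sub_le {R : realType} d (mu nu x y : 'rV[R]_d) (l : R) :
  enorm mu <= 1 -> enorm nu <= 1 ->
  (forall j, `|x 0 j - mu 0 j| < l) -> (forall j, `|y 0 j - nu 0 j| < l) ->
  enorm (x - y) <= d%:R * (2 * (1 + l)).
Proof.
move=> mu1 nu1 xmu ynu; rewrite (le_trans (enorm_le_sum _))//.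
rewrite mulr_natl -[X in _ *+ X]card_ord -sumr_const; apply: ler_sum => j _.
rewrite !mxE.
have := le_trans (abs_coord_le_enorm mu j) mu1.
have := le_trans (abs_coord_le_enorm nu j) nu1.
have := xmu j; have := ynu j.
rewrite !ltr_norml !ler_norml => /andP[? ?] /andP[? ?] /andP[? ?] /andP[? ?].
by apply/andP; split; lra.
Qed.

(* The reciprocal of [e / (d + 1) / D] with [e = delta sigma / (6 (d + 1))], the
   height bound, and [D = 2 d (1 + 2 sigma (d + 1) (1 + 1 / delta))], the
   diameter bound. *)
Definition condition_poly (R : realType) : mpoly.mpoly 3 R :=
  let v k := mpoly.mpolyX R (mpoly.mnm1 (inord k : 'I_3)) in
  12 * v 0%N * (v 0%N + 1) ^+ 2 * v 2%N * (v 1%N + 2 * (v 0%N + 1) * (1 + v 2%N)).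

Lemma eval3_condition_poly (R : realType) (x y z : R) :
  eval3 (condition_poly R) x y z =
  12 * x * (x + 1) ^+ 2 * z * (y + 2 * (x + 1) * (1 + z)).
Proof.
rewrite /eval3 /condition_poly.
have vE k : (k < 3)%N -> mpoly.meval (tnth [tuple x; y; z])
    (mpoly.mpolyX R (mpoly.mnm1 (inord k : 'I_3))) = nth 0 [:: x; y; z] k.
  by move=> k3; rewrite mpoly.mevalXU (tnth_nth 0) inordK.
by rewrite !(rmorphM, rmorphD, rmorphXn, rmorph1, rmorph_nat)/= !vE.
Qed.

Local Ltac gt0_tac :=
  repeat first [done | apply: mulr_gt0 | apply: addr_gt0 | apply: exprn_gt0].

Theorem theorem1p2 (R : realType) :
  exists p : mpoly.mpoly 3 R,
    (forall (d : nat) (sigma delta : R),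
       (1 <= d)%N -> 0 < sigma -> 0 < delta ->
       0 < eval3 p d%:R (1 / sigma) (1 / delta)) /\
    forall (d : nat) (sigma : R), (1 <= d)%N -> 0 < sigma ->
    forall (dT : measure_display) (T : measurableType dT) (P : probability T R)
           (mu : 'I_d.+1 -> 'rV[R]_d) (X : 'I_d.+1 -> T -> 'rV[R]_d),
      (forall i, enorm (mu i) <= 1) ->
      (forall i, gaussian_vector P (X i)) ->
      (forall i, has_mean P (X i) (mu i)) ->
      (forall i, has_covariance P (X i) ((sigma ^+ 2)%:M)) ->
      independent_vectors P X ->
    forall delta : R, 0 < delta ->
    exists E : set T,
      [/\ measurable E,
          E `<=` [set t | 1 / eval3 p d%:R (1 / sigma) (1 / delta)
                          <= kappa [set X i t | i in [set: 'I_d.+1]]]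
        & ((1 - delta)%:E <= P E)%E].
Proof.
exists (condition_poly R); split=> [d sg dl d1 sg0 dl0|].
  have dR0 : 0 < d%:R :> R by rewrite ltr0n.
  have dR1 : 0 < d%:R + 1 :> R by rewrite addr_gt0.
  have isg0 : 0 < 1 / sg by rewrite divr_gt0.
  have idl0 : 0 < 1 / dl by rewrite divr_gt0.
  have idl1 : 0 < 1 + 1 / dl by rewrite addr_gt0.
  rewrite eval3_condition_poly; gt0_tac.
move=> d sg d1 sg0 dT T P mu X mu1 GX meanX covX indX dl dl0.
rewrite eval3_condition_poly.
(* [e] gives the [d + 1] low-height events total probability at most [dl / 2]; [lam], the deviation
   threshold in units of [sg], does the same for the [(d + 1) * d] coordinate deviations. *)
pose n : R := d.+1%:R; pose lam := 2 * n * (1 + 1 / dl).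
pose e := dl * sg / (6 * n); pose l := sg * lam.
have n0 : 0 < n by rewrite ltr0n.
have dle : d%:R + 1 = n by rewrite /n -natr1.
have d0 : 0 < d%:R :> R by rewrite ltr0n.
have e0 : 0 < e by rewrite /e divr_gt0//; gt0_tac.
have idl : 0 < 1 / dl by rewrite divr_gt0.
have lam0 : 0 < lam by rewrite /lam; gt0_tac.
have l0 : 0 < l by rewrite mulr_gt0.
pose low i := [set t | low_height (X^~ t) i e].
pose dev (ij : 'I_d.+1 * 'I_d) := [set t | l <= `|X ij.1 t 0 ij.2 - mu ij.1 0 ij.2|].
have [mlow Plow] : measurable (\big[setU/set0]_i low i) /\
    (P (\big[setU/set0]_i low i) <= (#|'I_d.+1|%:R * (3 * e / sg))%:E)%E.
  apply: probability_bigsetU_le => i.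
    by apply: measurable_low_height => j k; exact: measurable_coord P (X j) (GX j) k.
  exact: (low_height_probability P X sg d1 sg0 GX covX indX i e (ltW e0)).
have [mdev Pdev] : measurable (\big[setU/set0]_ij dev ij) /\
    (P (\big[setU/set0]_ij dev ij) <=
      (#|{: 'I_d.+1 * 'I_d}|%:R * (sg ^+ 2 / l ^+ 2))%:E)%E.
  apply: probability_bigsetU_le => -[i j].
    have mY : measurable_fun setT (fun t => `|X i t 0 j - mu i 0 j|).
      apply: measurableT_comp => //; apply: measurable_funB => //.
      exact: measurable_coord P (X i) (GX i) j.
    rewrite -[dev _]setTI; exact: measurable_fun_le.
  exact: (gaussian_vector_chebyshev P (X i) (GX i) sg (mu i) j l l0 (meanX i) (covX i)).
(* The bad event: outside it, all heights are at least [e] and all coordinates are within [l] of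
   their means. *)
pose B := \big[setU/set0]_i low i `|` \big[setU/set0]_ij dev ij.
have mB : measurable B by exact: measurableU.
exists (~` B); split; first exact: measurableC.
  move=> t nB /=.
  have hX : heights_ge (X^~ t) e.
    apply: heights_ge_not_low => [|i low_i]; first exact: ltW.
    by apply: nB; left; apply: (sub_bigsetU _ low i).
  have devX i j : `|X i t 0 j - mu i 0 j| < l.
    rewrite ltNge; apply/negP => dev_ij; apply: nB; right.
    exact: (sub_bigsetU _ dev (i, j)).
  have XD i j : enorm (X i t - X j t) <= d%:R * (2 * (1 + l)).
    exact: enorm_sub_le (mu1 i) (mu1 j) (devX i) (devX j).
  apply: le_trans (kappa_ge (X^~ t) e e0 hX _ _ XD); last by rewrite ltnS.
  (* The polynomial was built so that its reciprocal is exactly this lower bound, hence an equality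
     of rational functions. *)
  rewrite le_eqVlt; apply/orP; left; apply/eqP.
  rewrite /e /l /lam -/n dle.
  have dR1 : 0 < 1 + d%:R :> R by rewrite addr_gt0.
  have den0 : 0 < dl + sg * (2 * (1 + d%:R) * (dl + 1)).
    by gt0_tac.
  by field; rewrite !gt_eqF.
rewrite probability_setC// EFinB leeB//.
apply: le_trans (measureU2 _ _ _) _ => //.
apply: le_trans (leeD Plow Pdev) _.
rewrite -EFinD lee_fin card_prod !card_ord -/n.
have -> : n * (3 * e / sg) = dl / 2 by rewrite /e; field; rewrite !gt_eqF.
have -> : (d.+1 * d)%:R * (sg ^+ 2 / l ^+ 2) = n * d%:R / lam ^+ 2.
  by rewrite natrM -/n /l; field; rewrite !gt_eqF.
suff : n * d%:R / lam ^+ 2 <= dl / 2 by lra.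
rewrite ler_pdivrMr ?exprn_gt0//.
have -> : dl / 2 * lam ^+ 2 = 2 * n ^+ 2 * (dl * (1 + 1 / dl) ^+ 2).
  by rewrite /lam; field; rewrite gt_eqF.
have dln : n * d%:R <= n ^+ 2 by rewrite expr2 ler_pM2l// -dle lerDl.
(* The form [1 + 1 / dl] in [lam] makes this hold for every positive [dl], large or small. *)
have : 1 <= dl * (1 + 1 / dl) ^+ 2.
  have -> : dl * (1 + 1 / dl) ^+ 2 = dl + 2 + 1 / dl by field; rewrite gt_eqF.
  lra.
have n2 : 0 < n ^+ 2 by rewrite exprn_gt0.
set y := dl * _ => y1.
nra.
Qed.
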